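(* Let $X$ be a locally compact Hausdorff space and let $\mathcal{H}$ be a finite-dimensional complex Hilbert space. If $\nu_1,\nu_2,\nu_3\in\mathrm{POVM}^1_{\mathcal{H}}(X)$ satisfy $\nu_1\ll_{\rm ac}\nu_2\ll_{\rm ac}\nu_3$, then $$\frac{\mathrm{d}\nu_1}{\mathrm{d}\nu_2}\boxtimes\frac{\mathrm{d}\nu_2}{\mathrm{d}\nu_3}=\frac{\mathrm{d}\nu_1}{\mathrm{d}\nu_3}$$ (equality up to sets of $\nu_3$-measure zero).
   Context: Let $d=\dim\mathcal{H}$; $\mathcal{O}(X)$ is the Borel $\sigma$-algebra of $X$; $\mathcal{B}(\mathcal{H})_+$ is the cone of positive operators. A state is a positive operator $\rho$ with $\operatorname{Tr}(\rho)=1$. $\mathrm{POVM}^1_{\mathcal{H}}(X)$ is the set of functions $\nu:\mathcal{O}(X)\to\mathcal{B}(\mathcal{H})$ with $\nu(E)\in\mathcal{B}(\mathcal{H})_+$ for all $E$, $\nu(X)=1$, countably additive on pairwise disjoint families ($\sigma$-weak convergence). $\nu\ll_{\rm ac}\nu'$ means $\nu(E)=0$ whenever $\nu'(E)=0$. A quantum random variable is a function $\psi:X\to\mathcal{B}(\mathcal{H})$ such that $x\mapsto\operatorname{Tr}(\rho\psi(x))$ is measurable for every state $\rho$. For such $\nu$, $\mu_\nu=\frac1d\operatorname{Tr}\circ\nu$, and $\mathrm{d}\nu/\mathrm{d}\mu_\nu:X\to\mathcal{B}(\mathcal{H})_+$ is the Radon-Nikodým derivative: $\nu(E)=\int_E\frac{\mathrm{d}\nu}{\mathrm{d}\mu_\nu}\,\mathrm{d}\mu_\nu$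 for all $E$. Write $\mu_j=\mu_{\nu_j}$. $\psi$ is $\nu$-integrable if for every state $\rho$ the function $\psi_\rho=\operatorname{Tr}\left(\rho\left(\frac{\mathrm{d}\nu}{\mathrm{d}\mu_\nu}\right)^{1/2}\psi\left(\frac{\mathrm{d}\nu}{\mathrm{d}\mu_\nu}\right)^{1/2}\right)$ is $\mu_\nu$-integrable; then $\int_X\psi\,\mathrm{d}\nu$ is the unique operator with $\operatorname{Tr}(\rho\int_X\psi\,\mathrm{d}\nu)=\int_X\psi_\rho\,\mathrm{d}\mu_\nu$ for every state $\rho$, and $\int_E\psi\,\mathrm{d}\nu=\int_X\chi_E\psi\,\mathrm{d}\nu$. For $a\in\mathcal{B}(\mathcal{H})_+$, $a^{-1}$ denotes the generalised inverse $\sum_{\lambda_k\ne0}\lambda_k^{-1}p_k$, where $a=\sum_k\lambda_kp_k$ is the spectral decomposition. For $\nu_i\ll_{\rm ac}\nu_j$, the Radon-Nikodým derivative $\frac{\mathrm{d}\nu_i}{\mathrm{d}\nu_j}$ is the bounded $\nu_j$-integrable quantum random variable $\varphi$ with $\nu_i(E)=\int_E\varphi\,\mathrm{d}\nu_j$ for all $E$; the paper cites a Radon-Nikodým theorem according to which such $\varphi$ exists, is unique up to sets of $\nu_j$-measure zero, and is given by $\varphi=\frac{\mathrm{d}\mu_i}{\mathrm{d}\mu_j}\left[\left(\frac{\mathrm{d}\nu_j}{\mathrm{d}\mu_j}\right)^{-1/2}\frac{\mathrm{d}\nu_i}{\mathrm{d}\mu_i}\left(\frac{\mathrm{d}\nu_j}{\mathrm{d}\mu_j}\right)^{-1/2}\right]$.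 Geometric mean: for invertible $a,b\in\mathcal{B}(\mathcal{H})_+$, $a\mathbin{\#}b=a^{1/2}(a^{-1/2}ba^{-1/2})^{1/2}a^{1/2}$; for non-invertible $a,b$, $a\mathbin{\#}b=\lim_{\varepsilon\to0+}(a+\varepsilon1)\mathbin{\#}(b+\varepsilon1)$ (strong operator topology). Definition of $\boxtimes$: for $\nu_i\ll_{\rm ac}\nu_j$ and a quantum random variable $\psi$, $$\psi\boxtimes\frac{\mathrm{d}\nu_i}{\mathrm{d}\nu_j}=\left(\left(\frac{\mathrm{d}\nu_j}{\mathrm{d}\mu_j}\right)^{-1}\mathbin{\#}\frac{\mathrm{d}\nu_i}{\mathrm{d}\nu_j}\right)\left(\frac{\mathrm{d}\nu_j}{\mathrm{d}\mu_j}\right)^{1/2}\psi\left(\frac{\mathrm{d}\nu_j}{\mathrm{d}\mu_j}\right)^{1/2}\left(\left(\frac{\mathrm{d}\nu_j}{\mathrm{d}\mu_j}\right)^{-1}\mathbin{\#}\frac{\mathrm{d}\nu_i}{\mathrm{d}\nu_j}\right).$$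
   Formalization: The formal statement assumes the three derivatives exist as bounded functions satisfying both the integral identity and the cited closed formula, since absolute continuity alone does not guarantee existence or uniqueness when a density is singular. *)

(* Defs.v *)
From HB Require Import structures.
From mathcomp Require Import all_boot all_order all_algebra.
From mathcomp Require Import sesquilinear spectral complex.
From mathcomp Require Import all_classical all_reals all_analysis.

Set Implicit Arguments.
Unset Strict Implicit.
Unset Printing Implicit Defensive.

Import Order.TTheory GRing.Theory Num.Theory.
Import numFieldNormedType.Exports.

Local Open Scope classical_set_scope.
Local Open Scope ring_scope.
Local Open Scope complex_scope.
Local Open Scope sesquilinear_scope.

(* The complex numbers, packed as a [numClosedFieldType] so that they inherit
   the usual topology (which is only declared on abstract number fields). *)
Definition Cplx (R : realType) : numClosedFieldType := R[i].
Arguments Cplx : simpl never.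

Definition toC (R : realType) (x : R) : Cplx R := x%:C.
Definition ReC (R : realType) (z : Cplx R) : R := complex.Re z.
Definition ImC (R : realType) (z : Cplx R) : R := complex.Im z.

(* H is C^n and operators are matrices acting on column vectors. Over C the
   condition below implies that A is hermitian. *)

Definition psdmx (R : realType) (n : nat) (A : 'M[Cplx R]_n) : Prop :=
  forall v : 'cV[Cplx R]_n, 0 <= (v ^t* *m A *m v) 0 0.

Definition is_state (R : realType) (n : nat) (s : 'M[Cplx R]_n) : Prop :=
  psdmx s /\ \tr s = 1.

Definition vnorm (R : realType) (n : nat) (v : 'cV[Cplx R]_n) : Cplx R :=
  sqrtC ((v ^t* *m v) 0 0).

(* Functional calculus: f(A) = \sum_k f(lambda_k) p_k for a normal matrix
   A = \sum_k lambda_k p_k. *)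
Definition mxfun (R : realType) (n : nat) (f : Cplx R -> Cplx R)
    (A : 'M[Cplx R]_n) : 'M[Cplx R]_n :=
  invmx (spectralmx A) *m diag_mx (map_mx f (spectral_diag A))
    *m spectralmx A.

Definition sqrtmx (R : realType) (n : nat) (A : 'M[Cplx R]_n) :
    'M[Cplx R]_n :=
  mxfun sqrtC A.

(* Since 0^-1 = 0, the next two are generalised inverses. *)
Definition ginvmx (R : realType) (n : nat) (A : 'M[Cplx R]_n) :
    'M[Cplx R]_n :=
  mxfun GRing.inv A.

Definition ginvsqrtmx (R : realType) (n : nat) (A : 'M[Cplx R]_n) :
    'M[Cplx R]_n :=
  mxfun (fun z => (sqrtC z)^-1) A.

Definition gmean_unit (R : realType) (n : nat) (a b : 'M[Cplx R]_n) :
    'M[Cplx R]_n :=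
  sqrtmx a *m sqrtmx (ginvsqrtmx a *m b *m ginvsqrtmx a) *m sqrtmx a.

(* The topology of the type of matrices is the entrywise one; in finite
   dimension it is the strong operator topology. *)
Definition gmean (R : realType) (n : nat) (a b : 'M[Cplx R]_n) :
    'M[Cplx R]_n :=
  if (a \in unitmx) && (b \in unitmx) then gmean_unit a b
  else lim ((fun e : R => gmean_unit (a + (toC e)%:M) (b + (toC e)%:M))
              @ 0^'+).

Notation borel X := (g_sigma_algebraType (@open X)).

(* The values of [povm_fun] outside the Borel sets are irrelevant. *)
Record povm (R : realType) (X : ptopologicalType) (n : nat) := Povm {
  povm_fun :> set (borel X) -> 'M[Cplx R]_n ;
  povm_psd : forall E, measurable E -> psdmx (povm_fun E) ;
  povm_setT : povm_fun setT = 1%:M ;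
  povm_sigma_additive : forall F : nat -> set (borel X),
    (forall k, measurable (F k)) -> trivIset setT F ->
    forall t : 'M[Cplx R]_n,
      (fun k => \tr (t *m \sum_(j < k) povm_fun (F j))) @ \oo
        --> \tr (t *m povm_fun (\bigcup_k F k)) }.

Definition povm_ac (R : realType) (X : ptopologicalType) (n : nat)
    (nu nu' : povm R X n) : Prop :=
  forall E, measurable E -> nu' E = 0 -> nu E = 0.

Definition povm_ae (R : realType) (X : ptopologicalType) (n : nat)
    (nu : povm R X n) (P : X -> Prop) : Prop :=
  exists N : set (borel X),
    [/\ measurable N, nu N = 0 & forall x, ~ N x -> P x].

(* mu_nu = n^-1 Tr o nu on the Borel sets; it is set to 0 elsewhere because
   the library wants measures to be nonnegative on all sets. *)
Definition povm_mu (R : realType) (X : ptopologicalType) (n : nat)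
    (nu : povm R X n) (E : set (borel X)) : \bar R :=
  if E \in measurable then (n%:R^-1 * ReC (\tr (nu E)))%:E else 0%E.

Section povm_mu_measure.
Context (R : realType) (X : ptopologicalType) (n : nat) (nu : povm R X n).

Lemma psdmx_tr_ge0 (A : 'M[Cplx R]_n) : psdmx A -> 0 <= \tr A.
Proof.
move=> A0; apply: sumr_ge0 => i _.
have := A0 (delta_mx i 0); rewrite trmx_delta map_delta_mx -rowE -colE.
by rewrite !mxE.
Qed.

Lemma ReC_ge0 (z : Cplx R) : 0 <= z -> 0 <= ReC z.
Proof. by case: z => a b; rewrite lecE /= => /andP[]. Qed.

Lemma ReC_continuous : continuous (@ReC R).
Proof.
move=> z; apply/(@cvgrPdist_lt _ _ _ (nbhs z) (nbhs_filter z)) => e e0.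
have eC : 0 < toC e by rewrite ltcR.
have := nbhsx_ballx z (toC e) eC; rewrite -ball_normE; apply: filterS => w.
case: z w => [a b] [c d] h; rewrite -ltcR; apply: le_lt_trans h.
exact: (normc_ge_Re ((a +i* b) - (c +i* d))).
Qed.

Lemma povm_mu_sum (F : nat -> set (borel X)) :
  (forall k, measurable (F k)) -> trivIset setT F ->
  (fun k => n%:R^-1 * ReC (\tr (\sum_(j < k) nu (F j)))) @ \oo
     --> n%:R^-1 * ReC (\tr (nu (\bigcup_k F k))).
Proof.
move=> mF tF; apply: cvgMr.
have h := @povm_sigma_additive _ _ _ nu _ mF tF 1%:M.
rewrite mul1mx in h; apply: continuous_cvg; first exact: ReC_continuous.
by apply: cvg_trans h; apply: near_eq_cvg; near=> k; rewrite mul1mx.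
Unshelve. all: by end_near.
Qed.

Lemma povm_muE (E : set (borel X)) :
  measurable E -> povm_mu nu E = (n%:R^-1 * ReC (\tr (nu E)))%:E.
Proof. by move=> mE; rewrite /povm_mu mem_set. Qed.

Lemma povm_mu_ge0 (E : set (borel X)) : (0 <= povm_mu nu E)%E.
Proof.
rewrite /povm_mu; case: ifPn => // /set_mem mE.
rewrite lee_fin mulr_ge0 ?invr_ge0 ?ler0n//.
exact/ReC_ge0/psdmx_tr_ge0/povm_psd.
Qed.

Lemma ReCD (z w : Cplx R) : ReC (z + w) = ReC z + ReC w.
Proof. by case: z w => [a b] [c d]. Qed.

Lemma ReC_sum (k : nat) (F : nat -> 'M[Cplx R]_n) :
  n%:R^-1 * ReC (\tr (\sum_(j < k) F j))
    = \sum_(0 <= j < k) n%:R^-1 * ReC (\tr (F j)).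
Proof.
elim: k => [|k IH]; first by rewrite big_ord0 big_nil mxtrace0 mulr0.
by rewrite big_ord_recr big_nat_recr//= raddfD ReCD mulrDr IH.
Qed.

Lemma povm_mu0 : povm_mu nu set0 = 0%E.
Proof.
rewrite povm_muE//; set c := _ * _; congr _%:E.
have t0 : trivIset [set: nat] (fun=> set0 : set (borel X)).
  by move=> i j _ _ [x []].
have := povm_mu_sum (fun=> measurable0) t0.
rewrite bigcup0// -/c.
rewrite (_ : (fun k => _) = (fun k => c *+ k)); last first.
  apply/funext => k; rewrite (ReC_sum k (fun=> nu set0)).
  by rewrite big_const_nat subn0 iter_addr_0.
move=> h; have h1 : (fun k => c *+ k.+1) @ \oo --> c.
  by rewrite -cvg_shiftS in h.
have e : (fun k => c *+ k.+1) - (fun k => c *+ k) = cst c.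
  by apply/funext => k; rewrite fctE mulrS addrK.
have : cst c @ \oo --> c - c by rewrite -e; exact: cvgB.
rewrite subrr => /cvg_lim h0; rewrite -h0//.
by apply/esym/cvg_lim => //; exact: cvg_cst.
Qed.

Lemma povm_mu_semi_sigma_additive : semi_sigma_additive (povm_mu nu).
Proof.
move=> F mF tF mUF; rewrite povm_muE//.
rewrite (_ : (fun k => _) =
    EFin \o (fun k => n%:R^-1 * ReC (\tr (\sum_(j < k) nu (F j))))).
  by apply: cvg_EFin; [exact: nearW|exact: povm_mu_sum].
apply/funext => k /=; rewrite (ReC_sum k (fun j => nu (F j))) -sumEFin.
by apply: eq_bigr => j _; rewrite povm_muE.
Qed.

HB.instance Definition _ := isMeasure.Build _ (borel X) R (povm_mu nu)
  povm_mu0 povm_mu_ge0 povm_mu_semi_sigma_additive.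

Lemma povm_mu_fin : fin_num_fun (povm_mu nu).
Proof. by move=> E mE; rewrite povm_muE. Qed.

HB.instance Definition _ := Measure_isFinite.Build _ (borel X) R (povm_mu nu)
  povm_mu_fin.

End povm_mu_measure.

Definition cmeasurable d (T : measurableType d) (R : realType)
    (f : T -> Cplx R) : Prop :=
  measurable_fun setT (fun x => ReC (f x)) /\
  measurable_fun setT (fun x => ImC (f x)).

Definition cintegrable d (T : measurableType d) (R : realType)
    (mu : {measure set T -> \bar R}) (D : set T) (f : T -> Cplx R) : Prop :=
  mu.-integrable D (fun x => (ReC (f x))%:E) /\
  mu.-integrable D (fun x => (ImC (f x))%:E).

Definition cintegral d (T : measurableType d) (R : realType)
    (mu : {measure set T -> \bar R}) (D : set T) (f : T -> Cplx R) : Cplx R :=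
  (\int[mu]_(x in D) ReC (f x)) +i* (\int[mu]_(x in D) ImC (f x)).

Definition is_qrv (R : realType) (X : ptopologicalType) (n : nat)
    (psi : X -> 'M[Cplx R]_n) : Prop :=
  forall s, is_state s -> cmeasurable (fun x : borel X => \tr (s *m psi x)).

Definition is_bounded (R : realType) (X : ptopologicalType) (n : nat)
    (psi : X -> 'M[Cplx R]_n) : Prop :=
  exists M : R, forall x v, vnorm (psi x *m v) <= toC M * vnorm v.

(* [r] is (a version of) the derivative of [nu] with respect to [mu_nu]; the
   operator-valued integral is the weak one. *)
Definition is_density (R : realType) (X : ptopologicalType) (n : nat)
    (nu : povm R X n) (r : X -> 'M[Cplx R]_n) : Prop :=
  [/\ forall x, psdmx (r x),
      is_qrv r
    & forall E, measurable E -> forall s, is_state s ->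
        cintegrable (povm_mu nu) E (fun x => \tr (s *m r x)) /\
        \tr (s *m nu E) = cintegral (povm_mu nu) E (fun x => \tr (s *m r x))].

(* In the next three definitions [r] is a density of [nu]. *)
Definition povm_integrand (R : realType) (X : ptopologicalType) (n : nat)
    (r psi : X -> 'M[Cplx R]_n) (s : 'M[Cplx R]_n) (x : borel X) : Cplx R :=
  \tr (s *m (sqrtmx (r x) *m psi x *m sqrtmx (r x))).

Definition povm_integrable (R : realType) (X : ptopologicalType) (n : nat)
    (nu : povm R X n) (r psi : X -> 'M[Cplx R]_n) : Prop :=
  forall s, is_state s ->
    cintegrable (povm_mu nu) setT (povm_integrand r psi s).

(* [A] is the integral of [psi] over [X] against [nu]. *)
Definition is_povm_integral (R : realType) (X : ptopologicalType) (n : nat)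
    (nu : povm R X n) (r psi : X -> 'M[Cplx R]_n) (A : 'M[Cplx R]_n) : Prop :=
  forall s, is_state s ->
    \tr (s *m A) = cintegral (povm_mu nu) setT (povm_integrand r psi s).

(* [phi] is the Radon-Nikodym derivative of [nui] with respect to [nuj].
   Where [rj x] is singular, the integral identity only determines the
   compression of [phi x] to the range of [rj x]; the closed formula of the
   last field selects the representative. *)
Record is_RN (R : realType) (X : ptopologicalType) (n : nat)
    (nui nuj : povm R X n) (ri rj phi : X -> 'M[Cplx R]_n) : Prop := IsRN {
  RN_qrv : is_qrv phi ;
  RN_bounded : is_bounded phi ;
  RN_integrable : povm_integrable nuj rj phi ;
  RN_integral : forall E : set (borel X), measurable E ->
    is_povm_integral nuj rj (fun x => toC (\1_E x) *: phi x) (nui E) ;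
  RN_formula : povm_ae nuj (fun x => phi x =
    toC (fine (Radon_Nikodym (charge_of_finite_measure (povm_mu nui))
                             (povm_mu nuj) x))
      *: (ginvsqrtmx (rj x) *m ri x *m ginvsqrtmx (rj x))) }.

(* Pointwise value of the product of psi with d nu_i / d nu_j, where
   r = d nu_j / d mu_j and phi = d nu_i / d nu_j. *)
Definition boxtimes (R : realType) (n : nat) (r psi phi : 'M[Cplx R]_n) :
    'M[Cplx R]_n :=
  gmean (ginvmx r) phi *m sqrtmx r *m psi *m sqrtmx r
    *m gmean (ginvmx r) phi.

(* Main.v *)
Require Import Defs.
From mathcomp Require Import all_boot all_order all_algebra.
From mathcomp Require Import sesquilinear spectral complex.
From mathcomp Require Import all_classical all_reals all_analysis.

Set Implicit Arguments.
Unset Strict Implicit.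
Unset Printing Implicit Defensive.

Import Order.TTheory GRing.Theory Num.Theory.
Import numFieldNormedType.Exports.

Local Open Scope classical_set_scope.
Local Open Scope ring_scope.
Local Open Scope sesquilinear_scope.

(** Write r_j for the density of nu_j with respect to its normalised trace mu_j,
    c_ij for the scalar Radon-Nikodym derivative of mu_i with respect to mu_j,
    g_j for the generalised inverse square root of r_j and P_j for the
    projection on the range of r_j.  The closed formula for the operator-valued
    derivatives reads phi_ij = c_ij g_j r_i g_j.

    If every matrix were invertible, the closed formula of the geometric mean
    would make inv(r3) # phi23 equal to G = g3 sqrt(c23 r2) g3, and
    cancelling square roots in G sqrt(r3) phi12 sqrt(r3) G would give
    c12 c23 g3 r1 g3, which is phi13 by the chain rule c13 = c12 c23.

    Singular matrices cause two difficulties.  The cancellations replace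
    identity matrices by the projections P_j, so they need
    range r2 <= range r3 and range r1 <= range r2.  Absolute continuity alone does
    not give these inclusions; they come from the integral identity satisfied
    by the operator-valued derivative.  Tested on the maximally mixed state, it
    says that c_ij = (c_ij / n) tr(P_j r_i P_j) almost everywhere, whereas the
    density r_i has trace n mu_i-almost everywhere.  Where c_ij <> 0,
    compressing r_i to the range of r_j thus does not change its trace, and
    positivity of r_i forces range r_i <= range r_j ([RN_supp]).

    Besides, the geometric mean of singular matrices is a limit.  In a basis that
    diagonalises r3, the inner factor of the regularised mean converges to
    s + (1 - P3) with s = c23 r2 ([mgmean_middle_cvg]), the square root is
    continuous on positive matrices ([msqrt_dist]), and the orthogonal summand
    1 - P3 is annihilated by the outer factors, so that the limit is again G
    ([mgmean_unit_cvg], [gmean_ginvmx]).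

    Finally phi12 is only controlled nu2-almost everywhere, while the
    conclusion is a nu3-almost everywhere one: a mu2-null set may have positive
    mu3-measure, but c23 vanishes mu3-almost everywhere on it
    ([scalar_density_ae]), and then both sides of the identity are zero. *)

(** * Functional calculus of positive matrices *)

(** Nothing in the finite-dimensional part is specific to the complex numbers:
    it holds over every numerical closed field.  At [Cplx R] the following
    notions are [psdmx], [mxfun], [sqrtmx], [ginvmx] and [ginvsqrtmx] by
    conversion. *)
Section definitions.
Context (C : numClosedFieldType) (n : nat).
Implicit Types A : 'M[C]_n.

Definition psd A : Prop := forall v : 'cV[C]_n, 0 <= (v ^t* *m A *m v) 0 0.

Definition mcalc (f : C -> C) A : 'M[C]_n :=
  invmx (spectralmx A) *m diag_mx (map_mx f (spectral_diag A)) *m spectralmx A.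

Definition msqrt A := mcalc sqrtC A.

Definition mginv A := mcalc GRing.inv A.

Definition mginvsqrt A := mcalc (fun z => (sqrtC z)^-1) A.

End definitions.

Section algebra.
Context (C : numClosedFieldType) (n : nat).
Implicit Types (A B T U : 'M[C]_n) (d : 'rV[C]_n) (f : C -> C).

Lemma trmxCM m p q (A : 'M[C]_(m, p)) (B : 'M[C]_(p, q)) :
  (A *m B)^t* = B^t* *m A^t*.
Proof. by rewrite trmx_mul map_mxM. Qed.

Lemma unitarymxE U : U \is unitarymx -> U *m U^t* = 1%:M /\ U^t* *m U = 1%:M.
Proof.
move=> uU; split; first exact/unitarymxP.
by apply/mulmx1C/unitarymxP.
Qed.

(** A matrix diagonalised by an arbitrary unitary [U], in contrast to the chosen
    [spectralmx] of the functional calculus. *)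
Definition udiag U d := U^t* *m diag_mx d *m U.

Lemma udiagM U d1 d2 : U \is unitarymx ->
  udiag U d1 *m udiag U d2 = udiag U (\row_i (d1 0 i * d2 0 i)).
Proof.
move=> /unitarymxE[UU _]; rewrite /udiag !mulmxA; congr (_ *m _).
rewrite -(mulmxA (_ *m _) U) UU mulmx1 -mulmxA; congr (_ *m _).
apply/matrixP => i j; rewrite mul_diag_mx !mxE.
by case: eqP => [->|_]; [rewrite !mulr1n|rewrite !mulr0n mulr0].
Qed.

Lemma udiagC U d : (udiag U d)^t* = udiag U (map_mx Num.conj d).
Proof.
rewrite /udiag !trmxCM trmxCK mulmxA tr_diag_mx; congr (_ *m _ *m _).
apply/matrixP => i j; rewrite !mxE.
by case: eqP => [->|_]; [rewrite !mulr1n|rewrite !mulr0n conjC0].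
Qed.

Lemma eq_udiag U d1 d2 : (forall i, d1 0 i = d2 0 i) -> udiag U d1 = udiag U d2.
Proof. by move=> h; congr udiag; apply/rowP. Qed.

Lemma udiag_scalar U (c : C) : U \is unitarymx ->
  udiag U (const_mx c) = c%:M.
Proof.
move=> /unitarymxE[_ UU].
by rewrite /udiag diag_const_mx mul_mx_scalar -scalemxAl UU scalemx1.
Qed.

Lemma udiagD U d1 d2 : udiag U d1 + udiag U d2 = udiag U (d1 + d2).
Proof. by rewrite /udiag raddfD mulmxDr mulmxDl. Qed.

(** The functional calculus does not depend on the diagonalisation: if two
    diagonal matrices are intertwined by [W], then [e i * W i j = W i j * d j],
    so that [W i j] vanishes unless [e i = d j], and [W] also intertwines their
    images under [f]. *)
Lemma mcalc_udiag f U d : U \is unitarymx ->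
  mcalc f (udiag U d) = udiag U (map_mx f d).
Proof.
move=> uU; have [UU UU'] := unitarymxE uU.
set A := udiag U d; have Anormal : A \is normalmx.
  apply/normalmxP; rewrite /A udiagC !udiagM//; apply: eq_udiag => i.
  by rewrite !mxE mulrC.
have uV := spectral_unitarymx A; have [VV VV'] := unitarymxE uV.
have := @orthomx_spectralP _ _ A.
move=> /elimT/(_ Anormal); rewrite /mcalc invmx_unitary//.
set V := spectralmx A in uV VV VV' *; set e := spectral_diag A => AE.
(* W is kept abstract, so that mxE leaves its entries alone. *)
have [W WE] : exists W, W = V *m U^t* by exists (V *m U^t*).
have We : diag_mx e *m W = W *m diag_mx d.
  rewrite WE mulmxA -[diag_mx e]mul1mx -VV -!mulmxA (mulmxA _ V) (mulmxA _ _ (U^t*)).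
  rewrite [V^t* *m _]mulmxA -AE /A /udiag.
  by rewrite -!mulmxA UU mulmx1.
have Wf : diag_mx (map_mx f e) *m W = W *m diag_mx (map_mx f d).
  apply/matrixP => i j; move/matrixP: We => /(_ i j).
  rewrite !mul_diag_mx !mul_mx_diag !mxE => h.
  have [->|w0] := eqVneq (W i j) 0; first by rewrite mulr0 mul0r.
  rewrite mulrC; congr (_ * f _).
  by move: h; rewrite mulrC => /(mulfI w0).
rewrite /udiag -[in LHS](mulmx1 V) -UU' (mulmxA V) -WE mulmxA -(mulmxA _ _ W) Wf.
by rewrite WE !mulmxA -(mulmxA V) UU' mulmx1 VV' mul1mx.
Qed.

(** A - A^* is antihermitian, hence diagonalisable, and its quadratic form
    vanishes because that of [A] is real; so all its eigenvalues are zero. *)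
Lemma psd_hermitian A : psd A -> A^t* = A.
Proof.
move=> A0; have qr (v : 'cV[C]_n) : (v^t* *m (A^t* - A) *m v) 0 0 = 0.
  have /CrealP := ger0_real (A0 v); rewrite mulmxBr mulmxBl.
  move=> h; rewrite mxE [X in _ + X]mxE -[X in _ - X]h.
  rewrite (_ : v^t* *m A^t* *m v = (v^t* *m A *m v)^t*); last first.
    by rewrite !trmxCM trmxCK mulmxA.
  by rewrite !mxE subrr.
set B := A^t* - A in qr.
suff : B = 0 by move/eqP; rewrite subr_eq0 => /eqP.
have Bnormal : B \is normalmx.
  apply/normalmxP; rewrite (_ : B^t* = - B) ?mulmxN ?mulNmx//.
  by rewrite /B linearB /= map_mxB trmxCK opprB.
have := @orthomx_spectralP _ _ B.
move=> /elimT/(_ Bnormal); set V := spectralmx B; set e := spectral_diag B.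
have uV : V \is unitarymx by exact: spectral_unitarymx.
have [VV _] := unitarymxE uV.
rewrite invmx_unitary// => BE.
suff e0 : e = 0 by rewrite BE e0 raddf0 mulmx0 mul0mx.
apply/rowP => k; rewrite [RHS]mxE.
have := qr (V^t* *m delta_mx k 0).
rewrite BE trmxCM trmxCK !mulmxA -(mulmxA _ V) VV mulmx1 -(mulmxA _ V) VV mulmx1.
by rewrite trmx_delta map_delta_mx -rowE -colE !mxE eqxx mulr1n.
Qed.

Lemma psd_udiagP A : psd A ->
  exists U d, [/\ U \is unitarymx, forall i, 0 <= d 0 i & A = udiag U d].
Proof.
move=> A0; have Anormal : A \is normalmx.
  by apply/normalmxP; rewrite psd_hermitian.
have := @orthomx_spectralP _ _ A.
move=> /elimT/(_ Anormal); set V := spectralmx A; set e := spectral_diag A.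
have uV : V \is unitarymx by exact: spectral_unitarymx.
have [VV _] := unitarymxE uV.
rewrite invmx_unitary// => AE; exists V, e; split => // k.
have := A0 (V^t* *m delta_mx k 0).
rewrite AE trmxCM trmxCK !mulmxA -(mulmxA _ V) VV mulmx1 -(mulmxA _ V) VV mulmx1.
by rewrite trmx_delta map_delta_mx -rowE -colE !mxE eqxx mulr1n.
Qed.

Lemma psd_congr A T : psd A -> psd (T^t* *m A *m T).
Proof.
by move=> A0 v; have := A0 (T *m v); rewrite trmxCM !mulmxA.
Qed.

Lemma psdD A B : psd A -> psd B -> psd (A + B).
Proof.
by move=> A0 B0 v; rewrite mulmxDr mulmxDl mxE addr_ge0.
Qed.

Lemma psd_udiag U d : (forall i, 0 <= d 0 i) -> psd (udiag U d).
Proof.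
move=> d0; apply: psd_congr => v.
rewrite mul_mx_diag mxE; apply: sumr_ge0 => i _.
by rewrite !mxE mulrAC mulr_ge0// mulrC mul_conjC_ge0.
Qed.

Lemma psdZ A (c : C) : 0 <= c -> psd A -> psd (c *: A).
Proof. by move=> c0 A0 v; rewrite -scalemxAr -scalemxAl mxE mulr_ge0. Qed.

Lemma psd_scalar (c : C) : 0 <= c -> psd (c%:M : 'M[C]_n).
Proof.
move=> c0; rewrite -scalemx1; apply: psdZ => // v.
rewrite mulmx1 mxE; apply: sumr_ge0 => i _.
by rewrite !mxE mulrC mul_conjC_ge0.
Qed.

Lemma msqrt_udiag U d : U \is unitarymx ->
  msqrt (udiag U d) = udiag U (map_mx sqrtC d).
Proof. exact: mcalc_udiag. Qed.

Lemma mginv_udiag U d : U \is unitarymx ->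
  mginv (udiag U d) = udiag U (map_mx GRing.inv d).
Proof. exact: mcalc_udiag. Qed.

Lemma mginvsqrt_udiag U d : U \is unitarymx ->
  mginvsqrt (udiag U d) = udiag U (map_mx (fun z => (sqrtC z)^-1) d).
Proof. exact: mcalc_udiag. Qed.

Lemma msqrt_psd A : psd A -> psd (msqrt A).
Proof.
move=> /psd_udiagP[U [d [uU d0 ->]]]; rewrite !msqrt_udiag//.
by apply: psd_udiag => i; rewrite mxE sqrtC_ge0.
Qed.

Lemma msqrtK A : psd A -> msqrt A *m msqrt A = A.
Proof.
move=> /psd_udiagP[U [d [uU d0 ->]]]; rewrite !msqrt_udiag// udiagM//.
by apply: eq_udiag => i; rewrite !mxE -expr2 sqrtCK.
Qed.

Lemma msqrtZ A (c : C) : psd A -> 0 <= c ->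
  msqrt (c *: A) = sqrtC c *: msqrt A.
Proof.
have udiagZ (e : C) U d : e *: udiag U d = udiag U (e *: d).
  by rewrite /udiag linearZ/= -scalemxAr -scalemxAl.
move=> /psd_udiagP[U [d [uU d0 ->]]] c0.
rewrite udiagZ !msqrt_udiag// udiagZ.
by apply: eq_udiag => i; rewrite !mxE rootCMl.
Qed.

Lemma mginvsqrt_psd A : psd A -> psd (mginvsqrt A).
Proof.
move=> /psd_udiagP[U [d [uU d0 ->]]]; rewrite !mginvsqrt_udiag//.
by apply: psd_udiag => i; rewrite mxE invr_ge0 sqrtC_ge0.
Qed.

Lemma mginv_psd A : psd A -> psd (mginv A).
Proof.
move=> /psd_udiagP[U [d [uU d0 ->]]]; rewrite !mginv_udiag//.
by apply: psd_udiag => i; rewrite mxE invr_ge0.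
Qed.

(** The orthogonal projection on the range of a positive matrix. *)
Definition supp A := msqrt A *m mginvsqrt A.

Lemma supp_udiag U d : U \is unitarymx ->
  supp (udiag U d) = udiag U (\row_i (d 0 i != 0)%:R).
Proof.
move=> uU; rewrite /supp msqrt_udiag// mginvsqrt_udiag// udiagM//.
apply: eq_udiag => i; rewrite !mxE.
by case: eqVneq => [->|di]; rewrite ?sqrtC0 ?mul0r// divff// sqrtC_eq0.
Qed.

Lemma suppE A : psd A -> supp A = mginvsqrt A *m msqrt A.
Proof.
move=> /psd_udiagP[U [d [uU d0 ->]]].
rewrite /supp msqrt_udiag// mginvsqrt_udiag// !udiagM//.
by apply: eq_udiag => i; rewrite !mxE mulrC.
Qed.

Lemma supp_herm A : psd A -> (supp A)^t* = supp A.
Proof.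
move=> /psd_udiagP[U [d [uU d0 ->]]]; rewrite supp_udiag// udiagC.
by apply: eq_udiag => i; rewrite !mxE conjC_nat.
Qed.

Lemma supp_idem A : psd A -> supp A *m supp A = supp A.
Proof.
move=> /psd_udiagP[U [d [uU d0 ->]]]; rewrite supp_udiag// udiagM//.
by apply: eq_udiag => i; rewrite !mxE -natrM mulnb andbb.
Qed.

Lemma supp_mginvsqrt A : psd A -> supp A *m mginvsqrt A = mginvsqrt A.
Proof.
move=> /psd_udiagP[U [d [uU d0 ->]]].
rewrite supp_udiag// mginvsqrt_udiag// udiagM//; apply: eq_udiag => i.
by rewrite !mxE; case: eqVneq => [->|_]; rewrite ?mul1r// mul0r sqrtC0 invr0.
Qed.

Lemma msqrt_supp A : psd A -> msqrt A *m supp A = msqrt A.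
Proof.
move=> /psd_udiagP[U [d [uU d0 ->]]].
rewrite supp_udiag// msqrt_udiag// udiagM//; apply: eq_udiag => i.
by rewrite !mxE; case: eqVneq => [->|_]; rewrite ?mulr1// sqrtC0 mulr0.
Qed.

Lemma mul_mginvsqrt A : psd A -> A *m mginvsqrt A = msqrt A.
Proof.
by move=> A0; rewrite -{1}(msqrtK A0) -mulmxA -/(supp A) msqrt_supp.
Qed.

Lemma msqrt_mginv A : psd A -> msqrt (mginv A) = mginvsqrt A.
Proof.
move=> /psd_udiagP[U [d [uU d0 ->]]].
rewrite mginv_udiag// msqrt_udiag// mginvsqrt_udiag//.
by apply: eq_udiag => i; rewrite !mxE rootCV.
Qed.

Lemma mginvsqrt_mginv A : psd A -> mginvsqrt (mginv A) = msqrt A.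
Proof.
move=> /psd_udiagP[U [d [uU d0 ->]]].
rewrite mginv_udiag// msqrt_udiag// mginvsqrt_udiag//.
by apply: eq_udiag => i; rewrite !mxE rootCV// invrK.
Qed.

Lemma supp_compl A : psd A ->
  [/\ psd (1%:M - supp A), (1%:M - supp A) *m (1%:M - supp A) = 1%:M - supp A &
      (1%:M - supp A) *m mginvsqrt A = 0].
Proof.
move=> A0; set Q := 1%:M - supp A.
have Qh : Q^t* = Q by rewrite linearB/= map_mxB trmx1 map_mx1 supp_herm.
have QQ : Q *m Q = Q.
  by rewrite {1}/Q mulmxBl mul1mx {2}/Q mulmxBr mulmx1 supp_idem// subrr subr0.
split => //; last by rewrite mulmxBl mul1mx supp_mginvsqrt// subrr.
rewrite -QQ -{1}Qh -[Q in _ *m Q]mul1mx mulmxA.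
by apply: psd_congr; exact: psd_scalar.
Qed.

Lemma supp_mulC A B : psd A -> psd B ->
  B *m supp A = B -> supp A *m B = B.
Proof.
move=> A0 B0 BP.
by rewrite -{2}(psd_hermitian B0) -{2}BP trmxCM (supp_herm A0) (psd_hermitian B0).
Qed.

Lemma mxtrace_gram_eq0 A : \tr (A^t* *m A) = 0 -> A = 0.
Proof.
move=> h; apply/matrixP => i j; rewrite [RHS]mxE.
have ge0 (k l : 'I_n) : 0 <= (A k l)^* * A k l by rewrite mulrC mul_conjC_ge0.
have : \sum_k \sum_l (A l k)^* * A l k = 0.
  by rewrite -[RHS]h; apply: eq_bigr => k _; rewrite mxE; apply: eq_bigr => l _;
    rewrite !mxE.
move/psumr_eq0P => /(_ (fun k _ => sumr_ge0 _ (fun l _ => ge0 l k)) j isT).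
move/psumr_eq0P => /(_ (fun l _ => ge0 l j) i isT) /eqP.
by rewrite mulrC mul_conjC_eq0 => /eqP.
Qed.

Lemma psd_tr0 A T : psd A -> \tr (T^t* *m A *m T) = 0 -> A *m T = 0.
Proof.
move=> A0; rewrite -{1}(msqrtK A0) -{1}(psd_hermitian (msqrt_psd A0)).
rewrite mulmxA -trmxCM -mulmxA => /mxtrace_gram_eq0 h.
by rewrite -(msqrtK A0) -mulmxA h mulmx0.
Qed.

(** With P the projection on the range of [S], the hypothesis says that the
    positive matrix (1 - P) A (1 - P) has trace zero, so A (1 - P) = 0. *)
Lemma mulmx_supp_of_tr A S : psd A -> psd S ->
  \tr (supp S *m A *m supp S) = \tr A -> A *m supp S = A.
Proof.
move=> A0 S0 h.
have [Q0 QQ _] := supp_compl S0.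
have PP := supp_idem S0; set P := supp S in h Q0 QQ PP *.
have /(_ (1%:M - P)) := psd_tr0 A0; rewrite (psd_hermitian Q0) => h2.
have hAP : \tr (A *m P) = \tr A.
  by rewrite -h -[in RHS]mulmxA [RHS]mxtrace_mulC -mulmxA PP.
have /eqP : A *m (1%:M - P) = 0.
  apply: h2; rewrite -mulmxA mxtrace_mulC -mulmxA QQ mulmxBr mulmx1.
  by rewrite raddfB/= hAP subrr.
by rewrite mulmxBr mulmx1 subr_eq0 => /eqP <-.
Qed.

Lemma unitarymx_entry_le1 U i j : U \is unitarymx -> `|U i j| <= 1.
Proof.
move=> /unitarymxP /matrixP /(_ i i); rewrite !mxE eqxx mulr1n => UU.
rewrite -(@ler_pXn2r _ 2)// ?nnegrE// expr1n -UU (bigD1 j)//= !mxE -normCK.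
by rewrite lerDl sumr_ge0// => k _; rewrite !mxE mul_conjC_ge0.
Qed.

(** Let X = sqrt A - sqrt B, with eigenvalue e and unit eigenvector w.  As
    A - B = (sqrt A) X + X (sqrt B), one has
    <w, (A - B) w> = e <w, (sqrt A + sqrt B) w>, and the last factor is at least
    |<w, X w>| = |e|.  Hence |e|^2 <= |<w, (A - B) w>|: every eigenvalue of X is
    controlled by the square root of the size of A - B. *)
Lemma msqrt_dist A B i j : psd A -> psd B ->
  `|(msqrt A - msqrt B) i j|
    <= n%:R * sqrtC (\sum_k \sum_l `|(A - B) k l|).
Proof.
move=> A0 B0; set D := \sum_k _.
have D0 : 0 <= D by rewrite sumr_ge0// => k _; rewrite sumr_ge0.
have := msqrt_psd A0; have := msqrt_psd B0.
have := msqrtK A0; have := msqrtK B0.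
move: (msqrt A) (msqrt B) => a b b2 a2 b0 a0.
set X := a - b; have Xh : X^t* = X.
  by rewrite /X linearB/= map_mxB (psd_hermitian a0) (psd_hermitian b0).
have Xnormal : X \is normalmx by apply/normalmxP; rewrite Xh.
have := @orthomx_spectralP _ _ X.
move=> /elimT/(_ Xnormal); set V := spectralmx X; set e := spectral_diag X.
have uV : V \is unitarymx by exact: spectral_unitarymx.
have [VV VV'] := unitarymxE uV.
rewrite invmx_unitary// => XE.
have ek k : `|e 0 k| <= sqrtC D.
  pose w := V^t* *m (delta_mx k 0 : 'cV[C]_n).
  have Xw : X *m w = e 0 k *: w.
    rewrite /w XE mulmxA -(mulmxA _ V) VV mulmx1 -mulmxA scalemxAr.
    congr (_ *m _); apply/matrixP => p q.
    rewrite mul_diag_mx !mxE; case: eqP => [->//|_].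
    by rewrite andFb !mulr0.
  have ww : (w^t* *m w) 0 0 = 1.
    rewrite /w trmxCM trmxCK mulmxA -(mulmxA _ V) VV mulmx1.
    by rewrite trmx_delta map_delta_mx -rowE !mxE !eqxx.
  have wX : w^t* *m X = (e 0 k)^* *: w^t*.
    by rewrite -{1}Xh -trmxCM Xw linearZ/= map_mxZ.
  set al := (w^t* *m a *m w) 0 0; set be := (w^t* *m b *m w) 0 0.
  have al0 : 0 <= al by exact: a0.
  have be0 : 0 <= be by exact: b0.
  have eE : e 0 k = al - be.
    have : (w^t* *m X *m w) 0 0 = e 0 k.
      by rewrite -mulmxA Xw -scalemxAr mxE ww mulr1.
    by move=> <-; rewrite /X mulmxBr mulmxBl mxE [X in _ + X]mxE.
  have er : (e 0 k)^* = e 0 k.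
    by rewrite eE rmorphB/= !(CrealP _)// ger0_real.
  have ABE : A - B = a *m X + X *m b.
    by rewrite /X mulmxBr mulmxBl a2 b2 addrA subrK.
  have h : (w^t* *m (A - B) *m w) 0 0 = e 0 k * (al + be).
    rewrite ABE mulmxDr mulmxDl -(mulmxA _ (a *m X)) -(mulmxA a) Xw.
    rewrite (mulmxA _ X) wX er -!scalemxAr -!scalemxAl mulmxA.
    by rewrite -scalerDr mxE [in LHS]mxE.
  have h2 : `|e 0 k| ^+ 2 <= `|(w^t* *m (A - B) *m w) 0 0|.
    rewrite h normrM expr2 ler_wpM2l// (ger0_norm (addr_ge0 al0 be0)) eE.
    by rewrite (le_trans (ler_normB _ _))// !ger0_norm.
  rewrite -(@ler_pXn2r _ 2)// ?nnegrE ?sqrtC_ge0// sqrtCK (le_trans h2)//.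
  rewrite mxE (le_trans (ler_norm_sum _ _ _))// /D exchange_big/=.
  apply: ler_sum => q _; rewrite mxE normrM.
  have wle p : `|w p 0| <= 1.
    rewrite /w -colE !mxE norm_conjC; exact: unitarymx_entry_le1.
  apply: le_trans (_ : `|\sum_p w^t* 0 p * (A - B) p q| * 1 <= _).
    by rewrite ler_wpM2l.
  rewrite mulr1 (le_trans (ler_norm_sum _ _ _))//.
  apply: ler_sum => p _; rewrite normrM [leRHS](_ : _ = 1 * `|(A - B) p q|).
    rewrite ler_wpM2r//; have := wle p.
    by rewrite [X in _ -> `|X| <= 1]mxE [X in _ -> `|X^*| <= 1]mxE norm_conjC.
  by rewrite mul1r.
rewrite XE mxE (le_trans (ler_norm_sum _ _ _))//.
rewrite mulr_natl -[n in _ *+ n]card_ord -sumr_const; apply: ler_sum => k _.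
rewrite mul_mx_diag !mxE !normrM norm_conjC.
apply: le_trans (ek k); rewrite -[leRHS]mul1r -[leRHS]mulr1.
by rewrite ler_pM// ?mulr_ge0// ?unitarymx_entry_le1// ler_wpM2r// unitarymx_entry_le1.
Qed.
End algebra.

Lemma mx_hausdorff (C : numClosedFieldType) (n : nat) : hausdorff_space 'M[C]_n.
Proof. exact: norm_hausdorff. Qed.

(** * Entrywise convergence of matrices *)

Section convergence.
Context (C : numClosedFieldType) (n : nat) (T : Type) (F : set_system T) {FF : Filter F}.
Implicit Types (A B : T -> 'M[C]_n) (M N : 'M[C]_n).

Lemma cvg_mxP A M : (forall i j, (fun t => A t i j) @ F --> M i j) -> A @ F --> M.
Proof.
move=> AM Q [P PM PQ]; change (F (A @^-1` Q)).
have : \forall t \near F, forall i j, P i j (A t i j).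
  apply: (filter_forall FF) => i; apply: (filter_forall FF) => j.
  exact: AM (PM i j).
by apply: filterS => t Pt; apply: PQ.
Qed.

Lemma cvg_mxE A M i j : A @ F --> M -> (fun t => A t i j) @ F --> M i j.
Proof.
move=> AM Q QM; change (F [set t | Q (A t i j)]).
apply: (AM [set N | Q (N i j)]).
exists (fun k l => if (k == i) && (l == j) then Q else setT).
  by move=> k l; case: ifP => [/andP[/eqP-> /eqP->]//|_]; exact: filterT.
by move=> N /(_ i j) /=; rewrite !eqxx.
Qed.

Lemma cvg_mulmx A B M N : A @ F --> M -> B @ F --> N ->
  (fun t => A t *m B t) @ F --> M *m N.
Proof.
move=> AM BN; apply: cvg_mxP => i j; rewrite mxE.
rewrite (_ : (fun t => _) = (fun t => \sum_k A t i k * B t k j)); last first.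
  by apply/funext => t; rewrite mxE.
apply: cvg_big => [|k _]; first exact: add_continuous.
by apply: cvgM; exact: cvg_mxE.
Qed.

Lemma cvg_sqrtC0 (x : T -> C) : (\forall t \near F, 0 <= x t) ->
  x @ F --> (0 : C) -> (fun t => sqrtC (x t)) @ F --> (0 : C).
Proof.
move=> x0 /cvgr0Pnorm_lt xF; apply/cvgr0Pnorm_lt => e e0.
apply: filterS2 x0 (xF _ (exprn_gt0 2 e0)) => t xt.
rewrite !ger0_norm ?sqrtC_ge0// => h.
by rewrite -(@ltr_pXn2r _ 2)// ?nnegrE ?sqrtC_ge0 ?(ltW e0)// sqrtCK.
Qed.

Lemma sqrtC_dist (a b : C) : 0 <= a -> 0 <= b ->
  `|sqrtC a - sqrtC b| <= sqrtC `|a - b|.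
Proof.
move=> a0 b0; rewrite -(@ler_pXn2r _ 2)// ?nnegrE ?sqrtC_ge0// sqrtCK.
rewrite -{2}(sqrtCK a) -{2}(sqrtCK b) subr_sqr normrM expr2 ler_wpM2l//.
have [a1 b1] : 0 <= sqrtC a /\ 0 <= sqrtC b by rewrite !sqrtC_ge0.
by rewrite (le_trans (ler_normB _ _))// !ger0_norm// addr_ge0.
Qed.

Lemma cvg_sqrtC (x : T -> C) (a : C) : (\forall t \near F, 0 <= x t) ->
  0 <= a -> x @ F --> a -> (fun t => sqrtC (x t)) @ F --> sqrtC a.
Proof.
move=> x0 a0 xF; apply/cvgrPdist_lt => e e0.
have : (fun t => sqrtC `|a - x t|) @ F --> (0 : C).
  apply: cvg_sqrtC0; first exact: nearW.
  apply/norm_cvg0P; rewrite -(subrr a); apply: cvgB => //; exact: cvg_cst.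
move=> /cvgr0Pnorm_lt /(_ _ e0); apply: filterS2 x0 => t xt.
rewrite ger0_norm ?sqrtC_ge0//; apply: le_lt_trans; exact: sqrtC_dist.
Qed.

Lemma cvg_msqrt A M : (\forall t \near F, psd (A t)) -> psd M ->
  A @ F --> M -> (fun t => msqrt (A t)) @ F --> msqrt M.
Proof.
move=> A0 M0 AM; apply: cvg_mxP => i j; apply/cvgrPdist_lt => e e0.
pose D t : C := \sum_k \sum_l `|(M - A t) k l|.
have D0 t : 0 <= D t by rewrite sumr_ge0// => k _; rewrite sumr_ge0.
have DF : D @ F --> (0 : C).
  rewrite [X in _ --> X](_ : _ = \sum_(k < n) \sum_(l < n) `|(M - M) k l| ); last first.
    by rewrite big1// => k _; rewrite big1// => l _; rewrite subrr mxE normr0.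
  apply: cvg_big => [|k _]; first exact: add_continuous.
  apply: cvg_big => [|l _]; first exact: add_continuous.
  apply: cvg_norm.
  rewrite !mxE; under eq_cvg do rewrite !mxE.
  by apply: cvgB; [exact: cvg_cst|exact: cvg_mxE].
have : (fun t => n%:R * sqrtC (D t)) @ F --> (n%:R * 0 : C).
  by apply: cvgM; [exact: cvg_cst|apply: cvg_sqrtC0 => //; exact: nearW].
rewrite mulr0 => /cvgr0Pnorm_lt /(_ _ e0); apply: filterS2 A0 => t At.
rewrite ger0_norm ?mulr_ge0 ?sqrtC_ge0//; apply: le_lt_trans.
have := msqrt_dist i j M0 At; rewrite mxE [X in _ + X]mxE; exact.
Qed.

End convergence.

(** * The regularised geometric mean *)

Section geometric_mean.
Context (C : numClosedFieldType) (n : nat).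
Implicit Types (r s U M N Q : 'M[C]_n) (d : 'rV[C]_n).

(** Counterpart of [gmean_unit] over an arbitrary numerical closed field. *)
Definition mgmean_unit M N : 'M[C]_n :=
  msqrt M *m msqrt (mginvsqrt M *m N *m mginvsqrt M) *m msqrt M.

Lemma msqrt_unique M N : psd M -> M *m M = N -> msqrt N = M.
Proof.
move=> /psd_udiagP[U [d [uU d0 ->]]] <-; rewrite udiagM// msqrt_udiag//.
by apply: eq_udiag => i; rewrite !mxE -expr2 rootCX// rootCK.
Qed.

(** The square root is additive on a direct sum with a projection. *)
Lemma msqrtD_orth M N Q : psd M -> psd Q -> M *m M = N ->
  Q *m M = 0 -> Q *m Q = Q -> msqrt (N + Q) = M + Q.
Proof.
move=> M0 Q0 MN QM QQ; apply: msqrt_unique; first exact: psdD.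
have MQ : M *m Q = 0.
  by rewrite -[LHS]trmxCK trmxCM (psd_hermitian M0) (psd_hermitian Q0) QM trmx0 map_mx0.
by rewrite mulmxDr !mulmxDl MN QM MQ QQ addr0 add0r.
Qed.

Lemma psd_conjh M N : psd M -> psd N -> psd (N *m M *m N).
Proof. by move=> M0 N0; rewrite -{1}(psd_hermitian N0); exact: psd_congr. Qed.

Context (T : Type) (F : set_system T) {FF : Filter F} (eps : T -> C).
Hypotheses (eps_gt0 : \forall t \near F, 0 < eps t) (eps_cvg : eps @ F --> (0 : C)).

Lemma cvg_addscalar M : (fun t => M + (eps t)%:M) @ F --> M.
Proof.
apply: cvg_mxP => i j; rewrite -[M i j]addr0.
under eq_cvg do rewrite !mxE.
apply: cvgD; first exact: cvg_cst.
by case: (i == j); [exact: eps_cvg|exact: cvg_cst].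
Qed.

Lemma cvg_udiag U (dt : T -> 'rV[C]_n) d :
  (forall i, (fun t => dt t 0 i) @ F --> d 0 i) ->
  (fun t => udiag U (dt t)) @ F --> udiag U d.
Proof.
move=> h; apply: cvg_mulmx; last exact: cvg_cst.
apply: cvg_mulmx; first exact: cvg_cst.
apply: cvg_mxP => i j; rewrite mxE; under eq_cvg do rewrite mxE.
by case: (i == j); [exact: h|exact: cvg_cst].
Qed.

Lemma near_psd_addscalar M : psd M -> \forall t \near F, psd (M + (eps t)%:M).
Proof.
move=> M0; apply: filterS eps_gt0 => e e0.
exact: (psdD M0 (psd_scalar (ltW e0))).
Qed.

(** The next two lemmas describe the regularised matrices on an eigenvector of r
    with eigenvalue [c].  The value [c^-1 = 0] at [c = 0] makes the factors behave
    differently on the range of r and on its kernel, where the divergence of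
    the first factor is cancelled by the generalised inverse. *)
Lemma cvg_supp_entry (c : C) : 0 <= c ->
  (fun t => (sqrtC (c^-1 + eps t))^-1 * (sqrtC c)^-1) @ F --> ((c != 0)%:R : C).
Proof.
move=> c0; case cE : (c == 0).
  rewrite (eqP cE); under eq_cvg do rewrite sqrtC0 invr0 mulr0.
  exact: cvg_cst.
have cN0 : c != 0 by rewrite cE.
rewrite [_%:R](_ : _ = (sqrtC c^-1)^-1 * (sqrtC c)^-1); last first.
  by rewrite rootCV// mulVf// invr_eq0 sqrtC_eq0.
apply: cvgM; last exact: cvg_cst.
apply: cvgV; first by rewrite rootCV// invr_eq0 sqrtC_eq0.
apply: cvg_sqrtC; rewrite ?invr_ge0//.
  by apply: filterS eps_gt0 => t t0; rewrite addr_ge0 ?invr_ge0// ltW.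
by rewrite -[X in _ --> X]addr0; apply: cvgD => //; exact: cvg_cst.
Qed.

Lemma cvg_compl_entry (c : C) : 0 <= c ->
  (fun t => eps t / (c^-1 + eps t)) @ F --> ((c == 0)%:R : C).
Proof.
move=> c0; case cE : (c == 0).
  rewrite (eqP cE); apply: (@cvg_trans _ ((fun=> 1 : C) @ F)); last exact: cvg_cst.
  apply: near_eq_cvg; apply: filterS eps_gt0 => t t0.
  by rewrite invr0 add0r divff// gt_eqF.
rewrite [_%:R](_ : _ = 0 * (c^-1 + 0)^-1); last by rewrite mul0r.
apply: cvgM => //; apply: cvgV; first by rewrite addr0 invr_eq0 cE.
by apply: cvgD => //; exact: cvg_cst.
Qed.

(** The factor under the square root splits as K s K + L, where K and L are
    diagonal in an eigenbasis of [r] and converge to the projections on the range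
    and on the kernel of [r]. *)
Lemma mgmean_middle_cvg r s : psd r -> s *m supp r = s -> supp r *m s = s ->
  (fun t => mginvsqrt (mginv r + (eps t)%:M)
      *m (mginvsqrt r *m s *m mginvsqrt r + (eps t)%:M)
      *m mginvsqrt (mginv r + (eps t)%:M)) @ F
    --> s + (1%:M - supp r).
Proof.
move=> /psd_udiagP[U [d [uU d0 ->]]] sP Ps.
have -> : s + (1%:M - supp (udiag U d)) =
    supp (udiag U d) *m s *m supp (udiag U d) + (1%:M - supp (udiag U d)).
  by rewrite Ps sP.
rewrite supp_udiag//.
have assoc (M N e : 'M[C]_n) :
    M *m (N *m s *m N + e) *m M = (M *m N) *m s *m (N *m M) + M *m e *m M.
  by rewrite mulmxDr mulmxDl !mulmxA.
pose k t : 'rV[C]_n :=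
  \row_i ((sqrtC ((d 0 i)^-1 + eps t))^-1 * (sqrtC (d 0 i))^-1).
pose l t : 'rV[C]_n := \row_i (eps t / ((d 0 i)^-1 + eps t)).
have aE t : mginv (udiag U d) + (eps t)%:M =
    udiag U (\row_i ((d 0 i)^-1 + eps t)).
  rewrite mginv_udiag// -(udiag_scalar (eps t) uU) udiagD.
  by apply: eq_udiag => i; rewrite !mxE.
have midE t :
    udiag U (k t) *m s *m udiag U (k t) + udiag U (l t) =
    mginvsqrt (mginv (udiag U d) + (eps t)%:M)
      *m (mginvsqrt (udiag U d) *m s *m mginvsqrt (udiag U d) + (eps t)%:M)
      *m mginvsqrt (mginv (udiag U d) + (eps t)%:M).
  rewrite aE !mginvsqrt_udiag// -(udiag_scalar (eps t) uU).
  rewrite assoc !udiagM//.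
  apply: (congr2 +%R); last first.
    by apply: eq_udiag => i; rewrite !mxE mulrAC -invfM -expr2 sqrtCK mulrC.
  apply: (congr2 mulmx); last by apply: eq_udiag => i; rewrite !mxE mulrC.
  by apply: (congr1 (mulmx^~ s)); apply: eq_udiag => i; rewrite !mxE.
under eq_cvg do rewrite -midE.
have kc i : (fun t => k t 0 i) @ F --> ((d 0 i != 0)%:R : C).
  by under eq_cvg do rewrite mxE; exact: cvg_supp_entry.
have lc i : (fun t => l t 0 i) @ F --> ((d 0 i == 0)%:R : C).
  by under eq_cvg do rewrite mxE; exact: cvg_compl_entry.
have PE : 1%:M - udiag U (\row_i (d 0 i != 0)%:R) = udiag U (\row_i (d 0 i == 0)%:R).
  apply/eqP; rewrite subr_eq udiagD -(udiag_scalar 1 uU); apply/eqP.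
  by apply: eq_udiag => i; rewrite !mxE -natrD; case: eqP.
rewrite PE; apply: cvgD.
  apply: cvg_mulmx; last by apply: cvg_udiag => i; rewrite mxE.
  by apply: cvg_mulmx; [apply: cvg_udiag => i; rewrite mxE|exact: cvg_cst].
by apply: cvg_udiag => i; rewrite mxE.
Qed.

(** The inner factor tends to s + (1 - P), with P the projection on the range of
    [r].  Its square root is sqrt s + (1 - P), and the outer factors, which tend
    to a matrix supported on the range of [r], annihilate 1 - P. *)
Lemma mgmean_unit_cvg r s : psd r -> psd s -> s *m supp r = s ->
  (fun t => mgmean_unit (mginv r + (eps t)%:M)
                (mginvsqrt r *m s *m mginvsqrt r + (eps t)%:M)) @ F
    --> mginvsqrt r *m msqrt s *m mginvsqrt r.
Proof.
move=> r0 s0 sP.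
have Ps := supp_mulC r0 s0 sP.
have [Q0 QQ Qg] := supp_compl r0.
set Q := 1%:M - supp r in Q0 QQ Qg.
have Qq : Q *m msqrt s = 0.
  by rewrite -(mul_mginvsqrt s0) mulmxA mulmxBl mul1mx Ps subrr mul0mx.
have sqrtsQ := msqrtD_orth (msqrt_psd s0) Q0 (msqrtK s0) Qq QQ.
have a0 := mginv_psd r0.
have cvgS : (fun t => msqrt (mginv r + (eps t)%:M)) @ F --> mginvsqrt r.
  rewrite -(msqrt_mginv r0); apply: cvg_msqrt => //.
    exact: near_psd_addscalar.
  exact: cvg_addscalar.
have -> : mginvsqrt r *m msqrt s *m mginvsqrt r =
    mginvsqrt r *m msqrt (s + Q) *m mginvsqrt r.
  by rewrite sqrtsQ mulmxDr mulmxDl -(mulmxA _ Q) Qg mulmx0 addr0.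
apply: cvg_mulmx; last exact: cvgS.
apply: cvg_mulmx; first exact: cvgS.
apply: cvg_msqrt; last exact: mgmean_middle_cvg.
- have gsg0 := psd_conjh s0 (mginvsqrt_psd r0).
  apply: filterS2 (near_psd_addscalar gsg0) (near_psd_addscalar a0) => t gsge ae.
  exact: (psd_conjh gsge (mginvsqrt_psd ae)).
- exact: (psdD s0 Q0).
Qed.

End geometric_mean.

(** * Cancellation of square roots *)

Section support_calculus.
Context (C : numClosedFieldType) (n : nat).
Implicit Types (r s t psi : 'M[C]_n) (c e : C).

(** Each product of a square root with a generalised inverse square root is a
    projection on a range, and the inclusions range t <= range s <= range r let
    the neighbouring factor absorb it. *)
Lemma supp_sandwich r s t :
  psd r -> psd s -> psd t -> s *m supp r = s -> t *m supp s = t ->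
  let G := mginvsqrt r *m msqrt s *m mginvsqrt r in
  G *m msqrt r *m (mginvsqrt s *m t *m mginvsqrt s) *m msqrt r *m G =
  mginvsqrt r *m t *m mginvsqrt r.
Proof.
move=> r0 s0 t0 sP tP G.
have Ps := supp_mulC r0 s0 sP; have Pt := supp_mulC s0 t0 tP.
have qP : supp r *m msqrt s = msqrt s by rewrite -(mul_mginvsqrt s0) mulmxA Ps.
have Pq : msqrt s *m supp r = msqrt s.
  rewrite -[LHS]trmxCK trmxCM (supp_herm r0) (psd_hermitian (msqrt_psd s0)) qP.
  exact: psd_hermitian (msqrt_psd s0).
have -> : G *m msqrt r = mginvsqrt r *m msqrt s.
  by rewrite /G -[LHS]mulmxA -(suppE r0) -mulmxA Pq.
rewrite -[LHS]mulmxA.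
have -> : msqrt r *m G = msqrt s *m mginvsqrt r.
  transitivity ((supp r *m msqrt s) *m mginvsqrt r); last by rewrite qP.
  by rewrite /G /supp !mulmxA.
transitivity (mginvsqrt r *m ((supp s *m t) *m (mginvsqrt s *m msqrt s)) *m mginvsqrt r).
  by rewrite /supp !mulmxA.
by rewrite Pt -(suppE s0) tP.
Qed.

Lemma msqrt_sandwich r s c : psd r ->
  msqrt r *m (c *: (mginvsqrt r *m s *m mginvsqrt r)) *m msqrt r =
  c *: (supp r *m s *m supp r).
Proof.
move=> r0; rewrite -scalemxAr -scalemxAl; congr (_ *: _).
by rewrite {2}(suppE r0) /supp !mulmxA.
Qed.

Lemma mgmean_unit_mginv r s : psd r -> psd s -> s *m supp r = s ->
  mgmean_unit (mginv r) (mginvsqrt r *m s *m mginvsqrt r) =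
  mginvsqrt r *m msqrt s *m mginvsqrt r.
Proof.
move=> r0 s0 sP; have Ps := supp_mulC r0 s0 sP.
rewrite /mgmean_unit (msqrt_mginv r0) (mginvsqrt_mginv r0).
by have := msqrt_sandwich s 1 r0; rewrite !scale1r Ps sP => ->.
Qed.

(** The hypotheses are guarded because, where a scalar derivative vanishes, nothing
    is known about ranges or about [psi]; there both sides are zero. *)
Lemma mgmean_sandwich r1 r2 r3 psi c e :
  psd r1 -> psd r2 -> psd r3 -> 0 <= c ->
  (c != 0 -> r2 *m supp r3 = r2) ->
  (c != 0 -> e != 0 -> r1 *m supp r2 = r1) ->
  (c != 0 -> psi = e *: (mginvsqrt r2 *m r1 *m mginvsqrt r2)) ->
  let G := mginvsqrt r3 *m msqrt (c *: r2) *m mginvsqrt r3 in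
  G *m msqrt r3 *m psi *m msqrt r3 *m G =
  (e * c) *: (mginvsqrt r3 *m r1 *m mginvsqrt r3).
Proof.
move=> p1 p2 p3 c0 r23 r12 psiE /=; rewrite (msqrtZ p2 c0).
have [cE|cN0] := eqVneq c 0.
  by rewrite cE sqrtC0 scale0r mulmx0 !mul0mx mulr0 scale0r.
rewrite psiE// -(scalemxAr _ (mginvsqrt r3)) -!(scalemxAl, scalemxAr) !scalerA.
have [->|eN0] := eqVneq e 0; first by rewrite !(mulr0, mul0r) !scale0r.
rewrite (supp_sandwich p3 p2 p1 (r23 cN0) (r12 cN0 eN0)).
by rewrite -expr2 sqrtCK.
Qed.

End support_calculus.

(** * The geometric mean and the product at a point *)

Section scalars.
Context (R : realType).
Local Notation C := (Cplx R).

Lemma toC_gt0 (e : R) : (0 < toC e) = (0 < e).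
Proof. exact: ltcR. Qed.

Lemma toC_ge0 (e : R) : (0 <= toC e) = (0 <= e).
Proof. exact: lecR. Qed.

Lemma toCM (a b : R) : toC (a * b) = toC a * toC b.
Proof. exact: rmorphM. Qed.

Lemma toC0 : toC 0 = 0 :> C.
Proof. by []. Qed.

Lemma toC_eq0 (a : R) : (toC a == 0) = (a == 0).
Proof. exact: (fmorph_eq0 (@real_complex R)). Qed.

Lemma ReC_toCM (a : R) (z : C) : ReC (toC a * z) = a * ReC z.
Proof. by case: z => x y; rewrite /ReC /toC/= mul0r subr0. Qed.

Lemma cvg_toC_at_right0 : (fun e : R => toC e) @ 0^'+ --> (0 : C).
Proof.
apply/cvgr0Pnorm_lt => e e0.
have [x [x0 xe]] : exists x : R, 0 < x /\ toC x = e.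
  case: e e0 => x y; rewrite ltcE/= => /andP[/eqP y0 x0]; by exists x; rewrite y0.
have : \forall t \near (0 : R)^'+, 0 < t < x.
  by near=> t; apply/andP; split; near: t; [exact: nbhs_right_gt|exact: nbhs_right_lt].
apply: filterS => t /andP[t0 tx].
by rewrite ger0_norm ?toC_ge0 ?ltW// -xe ltcR.
Unshelve. all: by end_near. Qed.

Lemma at_right0_toC_gt0 : \forall e \near (0 : R)^'+, 0 < toC e.
Proof. by apply: filterS (nbhs_right_gt 0) => e; rewrite toC_gt0. Qed.

End scalars.

Section boxtimes.
Context (R : realType) (n : nat).
Local Notation C := (Cplx R).
Implicit Types r s t psi : 'M[C]_n.

(** The mean may be defined by its closed formula or as a limit, according to
    invertibility; on matrices of this shape both give the same value. *)
Lemma gmean_ginvmx r s : psdmx r -> psdmx s -> s *m supp r = s ->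
  gmean (ginvmx r) (ginvsqrtmx r *m s *m ginvsqrtmx r) =
  ginvsqrtmx r *m sqrtmx s *m ginvsqrtmx r.
Proof.
move=> r0 s0 sP; rewrite /gmean; case: ifP => _; last first.
  apply: cvg_lim; first exact: mx_hausdorff.
  have h := mgmean_unit_cvg (@at_right0_toC_gt0 R) (@cvg_toC_at_right0 R) r0 s0 sP.
  exact: h.
exact: (mgmean_unit_mginv r0 s0 sP).
Qed.

Lemma boxtimes_chain r1 r2 r3 psi (c e : C) :
  psdmx r1 -> psdmx r2 -> psdmx r3 -> 0 <= c ->
  (c != 0 -> r2 *m supp r3 = r2) ->
  (c != 0 -> e != 0 -> r1 *m supp r2 = r1) ->
  (c != 0 -> psi = e *: (ginvsqrtmx r2 *m r1 *m ginvsqrtmx r2)) ->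
  boxtimes r3 psi (c *: (ginvsqrtmx r3 *m r2 *m ginvsqrtmx r3)) =
  (e * c) *: (ginvsqrtmx r3 *m r1 *m ginvsqrtmx r3).
Proof.
move=> p1 p2 p3 c0 r23 r12 psiE.
have cr2 : psdmx (c *: r2) := psdZ c0 p2.
have -> : c *: (ginvsqrtmx r3 *m r2 *m ginvsqrtmx r3) =
    ginvsqrtmx r3 *m (c *: r2) *m ginvsqrtmx r3.
  by rewrite -scalemxAr -scalemxAl.
have sP : (c *: r2) *m supp r3 = c *: r2.
  have [->|/r23 h] := eqVneq c 0; first by rewrite scale0r mul0mx.
  by rewrite -scalemxAl h.
rewrite /boxtimes (gmean_ginvmx p3 cr2 sP).
exact: (mgmean_sandwich p1 p2 p3 c0 r23 r12 psiE).
Qed.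

End boxtimes.

(** * Scalar densities and almost everywhere statements *)

Section povm_measure.
Context (R : realType) (X : ptopologicalType) (n : nat).
Hypothesis n_gt0 : (0 < n)%N.
Local Notation C := (Cplx R).
Implicit Types nu : povm R X n.

Lemma ge0_toC_ReC (z : C) : 0 <= z -> z = toC (ReC z).
Proof. by case: z => a b; rewrite lecE/= => /andP[/eqP ->]. Qed.

(** A positive matrix of trace zero is zero. *)
Lemma povm_mu_eq0 nu N : measurable N -> (nu N = 0) <-> (povm_mu nu N = 0%E).
Proof.
move=> mN; rewrite povm_muE//; split => [->|]; first by rewrite mxtrace0 mulr0.
move=> -[] /eqP; rewrite mulf_eq0 invr_eq0 pnatr_eq0 gtn_eqF//= => /eqP tr0.
have p := povm_psd nu mN.
rewrite -[LHS]mulmx1; apply: (psd_tr0 p).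
by rewrite trmx1 map_mx1 mul1mx mulmx1 (ge0_toC_ReC (psdmx_tr_ge0 p)) tr0 toC0.
Qed.

Lemma povm_aeP nu (P : X -> Prop) :
  povm_ae nu P <-> {ae povm_mu nu, forall x, P x}.
Proof.
split=> [] [N [mN N0 h]]; exists N; split => //.
- by apply/povm_mu_eq0.
- by move=> x /= Px; apply: contrapT => /h.
- by apply/povm_mu_eq0.
- by move=> x Nx; apply: contrapT => Px; apply: Nx; exact: h.
Qed.

Lemma povm_ac_dominates nu nu' : povm_ac nu nu' -> povm_mu nu `<< povm_mu nu'.
Proof.
move=> ac; apply/null_content_dominatesP => A mA /povm_mu_eq0 A0.
by apply/povm_mu_eq0 => //; apply: ac => //; exact: A0.
Qed.

Definition scalar_density (nui nuj : povm R X n) (x : X) : R :=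
  fine (Radon_Nikodym (charge_of_finite_measure (povm_mu nui)) (povm_mu nuj) x).

Section dominated.
Variables nui nuj : povm R X n.
Hypothesis ac : povm_ac nui nuj.
Let dom := povm_ac_dominates ac.

Lemma EFin_scalar_density x : (scalar_density nui nuj x)%:E =
  Radon_Nikodym (charge_of_finite_measure (povm_mu nui)) (povm_mu nuj) x.
Proof. by rewrite /scalar_density fineK//; exact: Radon_Nikodym_fin_num. Qed.

Lemma scalar_density_ge0 : {ae povm_mu nuj, forall x, 0 <= scalar_density nui nuj x}.
Proof.
have := ae_eq_Radon_Nikodym_SigmaFinite dom measurableT.
apply: filterS => x /(_ I) h.
by rewrite -lee_fin EFin_scalar_density -h Radon_Nikodym_SigmaFinite.f_ge0.
Qed.

(** On a mu_i-null set N, the scalar density integrates to zero over every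
    measurable subset of N, so it vanishes mu_j-almost everywhere on N. *)
Lemma scalar_density_ae (P : X -> Prop) :
  {ae povm_mu nui, forall x, P x} ->
  {ae povm_mu nuj, forall x, scalar_density nui nuj x != 0 -> P x}.
Proof.
move=> [N [mN N0 NP]].
have : ae_eq (povm_mu nuj) N
    (Radon_Nikodym (charge_of_finite_measure (povm_mu nui)) (povm_mu nuj)) (cst 0%E).
  apply: integral_ae_eq => //.
  - apply: (integrableS measurableT) => //; exact: Radon_Nikodym_integrable.
  - move=> E EN mE; rewrite integral0 -Radon_Nikodym_integral//.
    apply/eqP; rewrite -measure_le0/= -N0; apply: le_measure; by rewrite ?inE.
apply: filterS => x h; apply: contraNP => Px.
by rewrite /scalar_density h//; exact: NP.
Qed.

End dominated.

Lemma scalar_density_chain nu1 nu2 nu3 : povm_ac nu1 nu2 -> povm_ac nu2 nu3 ->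
  {ae povm_mu nu3, forall x, scalar_density nu1 nu3 x =
     scalar_density nu1 nu2 x * scalar_density nu2 nu3 x}.
Proof.
move=> ac12 ac23.
have := @Radon_Nikodym_chain_rule _ _ _ (charge_of_finite_measure (povm_mu nu1))
  (povm_mu nu3) (povm_mu nu2) (povm_ac_dominates ac12) (povm_ac_dominates ac23).
apply: filterS => x /(_ I) h.
by rewrite {1}/scalar_density h/= -!EFin_scalar_density.
Qed.

Definition mixed_state : 'M[C]_n := (n%:R^-1)%:M.

Lemma mixed_state_is_state : is_state mixed_state.
Proof.
split; first by apply: psd_scalar; rewrite invr_ge0.
by rewrite mxtrace_scalar -[LHS]mulr_natl mulfV// pnatr_eq0 -lt0n.
Qed.

Lemma mixed_state_tr (A : 'M[C]_n) : ReC (\tr (mixed_state *m A)) = n%:R^-1 * ReC (\tr A).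
Proof.
rewrite mul_scalar_mx mxtraceZ -ReC_toCM; congr (ReC (_ * _)).
by rewrite /toC fmorphV rmorph_nat.
Qed.

Lemma povm_mu_mixed nu E : measurable E ->
  povm_mu nu E = (ReC (\tr (mixed_state *m nu E)))%:E.
Proof. by move=> mE; rewrite povm_muE// mixed_state_tr. Qed.

(** Tested on the maximally mixed state, the integral of the density over any
    [E] is mu(E) itself, which is also the integral of 1. *)
Lemma density_tr nu r : is_density nu r ->
  {ae povm_mu nu, forall x, n%:R^-1 * ReC (\tr (r x)) = 1}.
Proof.
move=> [_ _ rP].
have int E : measurable E ->
    (povm_mu nu).-integrable E (fun x => (ReC (\tr (mixed_state *m r x)))%:E).
  by move=> mE; have [[]] := rP _ mE _ mixed_state_is_state.
have : ae_eq (povm_mu nu) setT (fun x => (ReC (\tr (mixed_state *m r x)))%:E) (cst 1%E).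
  apply: integral_ae_eq => //; first exact: int.
  move=> E _ mE; transitivity (povm_mu nu E); last by rewrite integral_cst// mul1e.
  rewrite povm_mu_mixed//.
  have [_ ->] := rP _ mE _ mixed_state_is_state.
  by rewrite /cintegral/= /Rintegral fineK//; apply: integrable_fin_num => //; exact: int.
by apply: filterS => x /(_ I) []; rewrite mixed_state_tr.
Qed.

(** The defining integral identity, tested on the maximally mixed state,
    computes mu_i(E); so does the integral of the scalar density. *)
Lemma RN_tr nui nuj ri rj phi : povm_ac nui nuj -> is_RN nui nuj ri rj phi ->
  {ae povm_mu nuj, forall x, scalar_density nui nuj x =
    n%:R^-1 * ReC (\tr (sqrtmx (rj x) *m phi x *m sqrtmx (rj x)))}.
Proof.
move=> ac RN; have dom := povm_ac_dominates ac.
have [int _] := RN_integrable RN mixed_state_is_state.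
pose h x := ReC (povm_integrand rj phi mixed_state x).
have : ae_eq (povm_mu nuj) setT (fun x => (h x)%:E)
    (Radon_Nikodym (charge_of_finite_measure (povm_mu nui)) (povm_mu nuj)).
  apply: integral_ae_eq => //.
  move=> E _ mE; rewrite -Radon_Nikodym_integral//=.
  transitivity (povm_mu nui E) => //.
  rewrite povm_mu_mixed// (RN_integral RN mE mixed_state_is_state).
  rewrite /cintegral/= /Rintegral.
  transitivity (fine (\int[povm_mu nuj]_x ((fun x => (h x)%:E) \_ E) x))%:E.
    rewrite -integral_mkcond fineK//; apply: integrable_fin_num => //.
    exact: (integrableS measurableT).
  congr EFin; congr fine; apply: eq_integral => x _.
  rewrite patchE /h /povm_integrand.
  rewrite -scalemxAr -scalemxAl -scalemxAr mxtraceZ ReC_toCM indicE.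
  by case: ifP => _; [rewrite mul1r|rewrite mul0r].
apply: filterS => x /(_ I) e.
by rewrite -mixed_state_tr /scalar_density -e.
Qed.

(** Inserting the closed formula for [phi] in [RN_tr] gives
    c = (c / n) tr(P r_i P), with P the projection on the range of r_j, whereas
    tr r_i = n where c <> 0.  So compression by P preserves the trace of r_i. *)
Lemma RN_supp nui nuj ri rj phi : povm_ac nui nuj ->
  is_density nui ri -> (forall x, psdmx (rj x)) -> is_RN nui nuj ri rj phi ->
  {ae povm_mu nuj, forall x, scalar_density nui nuj x != 0 ->
    ri x *m supp (rj x) = ri x}.
Proof.
move=> ac riP rj0 RN; have [ri0 _ _] := riP.
have h1 := scalar_density_ae ac (density_tr riP).
have h2 := RN_tr ac RN.
have h3 := iffLR (povm_aeP _ _) (RN_formula RN).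
have FF := ae_filter_ringOfSetsType (povm_mu nuj).
apply: filterS3 h1 h2 h3 => x; set c := scalar_density _ _ x => h1 h2 h3 c0.
apply: (mulmx_supp_of_tr (ri0 x) (rj0 x)).
have pP : psdmx (supp (rj x) *m ri x *m supp (rj x)).
  by have := psd_congr (supp (rj x)) (ri0 x); rewrite (supp_herm (rj0 x)).
rewrite (ge0_toC_ReC (psdmx_tr_ge0 pP)) (ge0_toC_ReC (psdmx_tr_ge0 (ri0 x))).
congr toC.
have nN0 : (n%:R : R)^-1 != 0 by rewrite invr_eq0 pnatr_eq0 -lt0n.
apply: (mulfI nN0); rewrite (h1 c0); apply: (mulfI c0); rewrite mulr1 mulrCA.
rewrite [RHS]h2 h3 -/c -ReC_toCM -mxtraceZ; congr (_ * ReC (\tr _)).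
exact: (esym (msqrt_sandwich (ri x) (toC c) (rj0 x))).
Qed.

End povm_measure.

Theorem mainTheorem4 (R : realType) (X : ptopologicalType) (n : nat)
  (hausdorffX : hausdorff_space X) (lcX : locally_compact [set: X])
  (nu1 nu2 nu3 : povm R X n)
  (nu12 : povm_ac nu1 nu2) (nu23 : povm_ac nu2 nu3)
  (r1 r2 r3 : X -> 'M[Cplx R]_n)
  (r1P : is_density nu1 r1) (r2P : is_density nu2 r2)
  (r3P : is_density nu3 r3)
  (phi12 phi23 phi13 : X -> 'M[Cplx R]_n)
  (phi12P : is_RN nu1 nu2 r1 r2 phi12)
  (phi23P : is_RN nu2 nu3 r2 r3 phi23)
  (phi13P : is_RN nu1 nu3 r1 r3 phi13) :
  povm_ae nu3 (fun x => boxtimes (r3 x) (phi12 x) (phi23 x) = phi13 x).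
Proof.
(* The normalisation of mu_nu is degenerate for n = 0, where all matrices are
   equal. *)
have [n0|n_gt0] := posnP n.
  have flat (A B : 'M[Cplx R]_n) : A = B.
    by apply/matrixP => i; have := ltn_ord i; rewrite [X in (_ < X)%N]n0.
  exists set0; split; [exact: measurable0|exact: flat|move=> x _; exact: flat].
have [p1 _ _] := r1P; have [p2 _ _] := r2P; have [p3 _ _] := r3P.
apply/(povm_aeP n_gt0).
(* The facts that are known only nu2-almost everywhere hold nu3-almost
   everywhere on the set where the scalar density of nu2 with respect to nu3
   does not vanish; elsewhere both sides of the equation are zero. *)
have formula12 := scalar_density_ae n_gt0 nu23
  (iffLR (povm_aeP n_gt0 _ _) (RN_formula phi12P)).
have formula13 := iffLR (povm_aeP n_gt0 _ _) (RN_formula phi13P).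
have formula23 := iffLR (povm_aeP n_gt0 _ _) (RN_formula phi23P).
have supp23 := RN_supp n_gt0 nu23 r2P p3 phi23P.
have supp12 := scalar_density_ae n_gt0 nu23
  (RN_supp n_gt0 nu12 r1P p2 phi12P).
have chain := scalar_density_chain n_gt0 nu12 nu23.
have c23_ge0 := scalar_density_ge0 n_gt0 nu23.
have FF := ae_filter_ringOfSetsType (povm_mu nu3).
apply: filterS (filterI
  (filterI (filterI formula12 formula13) (filterI formula23 chain))
  (filterI (filterI supp23 supp12) c23_ge0)) => x.
move=> [[[f12 f13] [f23 c13]] [[s23 s12] c0]].
rewrite f23 f13 -/(scalar_density nu1 nu3 x) c13 -/(scalar_density nu2 nu3 x) toCM.
refine (boxtimes_chain (p1 x) (p2 x) (p3 x) _ _ _ _); rewrite ?toC_ge0 ?toC_eq0.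
- exact: c0.
- exact: s23.
- exact: s12.
- exact: f12.
Qed.
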